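(* Let $n=2$ and $0<\varepsilon<\frac{1}{12}$. The volume of every 2-simplex in the outer space $X_2$ with respect to the Riemannian metric $$ds^2_\varepsilon=ds_0^2+\sum_{\sigma:\ \ell(\sigma)<2\varepsilon}\Big(\frac{d\ell_\varepsilon(\sigma)}{\ell_\varepsilon(\sigma)}\Big)^2$$ is finite, and hence the volume of $\mathrm{Out}(F_2)\backslash X_2$ with respect to the Riemannian metric $ds^2_\varepsilon$ is finite.
   Context: Outer space (for general $n\ge2$; here $n=2$). Graphs $G$ are finite connected graphs (loops and multiple edges allowed) with $\pi_1(G)\cong F_n$, with no vertex of valence 1 or 2 and no separating edge. A metric graph $(G,\ell)$ is such a graph with a length $\ell(e)>0$ for each edge, normalized by $\sum_e \ell(e)=1$. Let $R_n$ be the wedge of $n$ circles. A marking is a homotopy equivalence $h:G\to R_n$. Marked metric graphs are equivalent if there is an isometry between them commuting with the markings up to homotopy. $X_n$ is the set of equivalence classes. $\mathrm{Out}(F_n)$, identified with the group of homotopy classes of self homotopy equivalences $\varphi$ of $R_n$, acts by $\varphi\cdot(G,\ell,h)=(G,\ell,\varphi\circ h)$. Simplices. For a marked graph $(G,h)$ with edges $e_1,\dots,e_k$, varying $x_i=\ell(e_i)$ gives an open $(k-1)$-simplex $\Sigma_{(G,h)}=\{x\in\mathbb R^k: x_i>0,\ \sum x_i=1\}$ in $X_n$. $X_n$ is the disjoint union of these open simplices, and is a simplicial complex with some faces missing (a face obtained by letting some edge lengths be $0$ belongs to $X_n$ if and only if the union of those edges contains no homotopically nontrivial loop). Metric. A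 cycle $\sigma$ of $G$ is a connected subgraph homotopy equivalent to a circle and without separating edges; $\ell(\sigma)$ is the sum of the lengths of its edges. $\ell_\varepsilon(\sigma)$ is a fixed positive smooth function of $\ell(\sigma)$ with $\ell_\varepsilon(\sigma)=\varepsilon$ if $\ell(\sigma)\ge2\varepsilon$ and $\ell_\varepsilon(\sigma)=\ell(\sigma)$ if $\ell(\sigma)\le\varepsilon$. On each open simplex $\Sigma_{(G,h)}\subset\mathbb R^k$, $ds_0^2$ is the flat metric induced from $\mathbb R^k$, and the sum in $ds_\varepsilon^2$ is over cycles of $G$ of length less than $2\varepsilon$. Volume. The volume of a simplicial complex with a piecewise Riemannian metric is the sum of the volumes of its top-dimensional simplices; for $\mathrm{Out}(F_n)\backslash X_n$ these are the top-dimensional simplices of $X_n$ modulo $\mathrm{Out}(F_n)$, of which there are finitely many orbits. *)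

(* Defs.v *)
From HB Require Import structures.
From mathcomp Require Import all_boot all_order all_algebra.
From mathcomp Require Import lra.
From mathcomp Require Import all_classical all_reals all_analysis.

Set Implicit Arguments.
Unset Strict Implicit.
Unset Printing Implicit Defensive.

Import Order.TTheory GRing.Theory Num.Theory.
Import numFieldNormedType.Exports.

Local Open Scope classical_set_scope.
Local Open Scope ring_scope.

Section Homotopy.
Context (R : realType).

Definition homotopic (X Y : topologicalType) (f g : X -> Y) : Prop :=
  exists H : X * R -> Y,
    [/\ {within [set: X] `*` `[0, 1], continuous H},
        forall x, H (x, 0) = f x & forall x, H (x, 1) = g x].

Definition is_homotopy_equiv (X Y : topologicalType) (f : X -> Y) : Prop :=
  continuous f /\
  exists g : Y -> X,
    [/\ continuous g, homotopic (g \o f) id & homotopic (f \o g) id].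

Definition homotopy_equivalent (X Y : topologicalType) : Prop :=
  exists f : X -> Y, is_homotopy_equiv f.

Let cyl (X : topologicalType) (a b : R) : set (X * R) := [set: X] `*` `[a, b].

Let closed_cyl (X : topologicalType) a b : closed (@cyl X a b).
Proof.
have -> : @cyl X a b = snd @^-1` `[a, b].
  by apply/seteqP; split => -[x t] //= [].
apply: preimage_closed; last exact: interval_closed.
by move=> p _; exact: cvg_snd.
Qed.

Let within_cyl_comp (X Y : topologicalType) (a b : R) (H : X * R -> Y)
    (c d : R) :
  (forall t, a <= t <= b -> 0 <= c * t + d <= 1) ->
  {within @cyl X 0 1, continuous H} ->
  {within @cyl X a b, continuous (fun p => H (p.1, c * p.2 + d))}.
Proof.
move=> abc /subspace_continuousP cH; apply/subspace_continuousP => -[x t].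
move=> [_ /=]; rewrite in_itv /= => tab.
have xt01 : @cyl X 0 1 (x, c * t + d).
  by split => //=; rewrite in_itv /=; exact: abc.
have := cH _ xt01; apply: cvg_trans => P /= HP.
rewrite /nbhs /= /within /=.
have aff : {for (x, t), continuous (fun p : X * R => (p.1, c * p.2 + d))}.
  apply: (@cvg_pair _ _ _ (nbhs (x, t)) (nbhs x) (nbhs (c * t + d))).
    exact: cvg_fst.
  apply: cvgD; last exact: cvg_cst.
  by apply: cvgM; [exact: cvg_cst|exact: cvg_snd].
have := aff _ HP; rewrite /nbhs /= => Q.
apply: filterS Q => -[y s] /= Q [_ /=]; rewrite in_itv /= => sab.
by apply: Q; split => //=; rewrite in_itv /=; exact: abc.
Qed.

Lemma homotopic_refl (X Y : topologicalType) (f : X -> Y) :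
  continuous f -> homotopic f f.
Proof.
move=> cf; exists (f \o fst); split => //.
apply: continuous_subspaceT => -[x t]; apply: continuous_comp; last exact: cf.
exact: cvg_fst.
Qed.

Lemma homotopic_sym (X Y : topologicalType) (f g : X -> Y) :
  homotopic f g -> homotopic g f.
Proof.
move=> [H [cH H0 H1]]; exists (fun p => H (p.1, (-1) * p.2 + 1)); split.
- by apply: within_cyl_comp cH => t /andP[t0 t1]; lra.
- by move=> x /=; rewrite mulr0 add0r H1.
- by move=> x /=; rewrite mulr1 addNr H0.
Qed.

Lemma homotopic_trans (X Y : topologicalType) (g f h : X -> Y) :
  homotopic f g -> homotopic g h -> homotopic f h.
Proof.
move=> [H [cH H0 H1]] [K [cK K0 K1]].
pose L (p : X * R) :=
  if p.2 <= 2^-1 then H (p.1, 2 * p.2 + 0) else K (p.1, 2 * p.2 + (-1)).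
exists L; split; last 2 first.
- by move=> x; rewrite /L /= invr_ge0 ler0n mulr0 addr0.
- move=> x; rewrite /L /= ifF; last by apply/negbTE; rewrite -ltNge; lra.
  by rewrite mulr1 -[RHS]K1; congr (K (_, _)); lra.
have -> : [set: X] `*` `[0, 1 : R] = @cyl X 0 2^-1 `|` @cyl X 2^-1 1.
  apply/seteqP; split => -[x t]; rewrite /cyl /= !in_itv /=.
    move=> [_ /andP[t0 t1]]; have [t2|t2] := leP t 2^-1.
      by left; split => //; apply/andP.
    by right; split => //; apply/andP; split => //; exact: ltW.
  by move=> [|] [_ /andP[t0 t1]]; split => //; apply/andP; split; lra.
apply: withinU_continuous; [exact: closed_cyl|exact: closed_cyl| |].
- apply: (@subspace_eq_continuous _ (@cyl X 0 2^-1) _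
    (fun p : X * R => H (p.1, 2 * p.2 + 0))).
    move=> -[x t]; rewrite inE /cyl /= in_itv /= => -[_ /andP[t0 t1]].
    by rewrite /from_subspace /L /= t1.
  by apply: within_cyl_comp cH => t /andP[t0 t1]; lra.
- apply: (@subspace_eq_continuous _ (@cyl X 2^-1 1) _
    (fun p : X * R => K (p.1, 2 * p.2 + (-1)))).
    move=> -[x t]; rewrite inE /cyl /= in_itv /= => -[_ /andP[t0 t1]].
    rewrite /from_subspace /L /=; case: ifPn => // t2.
    have -> : t = 2^-1 by lra.
    by rewrite divff ?pnatr_eq0// addr0 addrN H1 K0.
  by apply: within_cyl_comp cK => t /andP[t0 t1]; lra.
Qed.

Lemma homotopic_compl (X Y Z : topologicalType) (f g : X -> Y) (k : Y -> Z) :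
  continuous k -> homotopic f g -> homotopic (k \o f) (k \o g).
Proof.
move=> ck [H [cH H0 H1]]; exists (k \o H); split.
- move/subspace_continuousP : cH => cH.
  apply/subspace_continuousP => p /cH cHp.
  exact: cvg_comp cHp (ck (H p)).
- by move=> x /=; rewrite H0.
- by move=> x /=; rewrite H1.
Qed.

Lemma homotopic_compr (X Y Z : topologicalType) (f g : Y -> Z) (k : X -> Y) :
  continuous k -> homotopic f g -> homotopic (f \o k) (g \o k).
Proof.
move=> ck [H [/subspace_continuousP cH H0 H1]].
exists (fun p => H (k p.1, p.2)); split.
- apply/subspace_continuousP => -[x t] [_ /= t01].
  have kt : ([set: Y] `*` `[0, 1]) (k x, t) by [].
  have := cH _ kt; apply: cvg_trans => P /= HP; rewrite /nbhs /= /within /=.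
  have kid : {for (x, t), continuous (fun p : X * R => (k p.1, p.2))}.
    apply: (@cvg_pair _ _ _ (nbhs (x, t)) (nbhs (k x)) (nbhs t)); last exact: cvg_snd.
    by apply: continuous_comp; [exact: cvg_fst|exact: ck].
  have := kid _ HP; rewrite /nbhs /= => Q.
  by apply: filterS Q => -[y s] /= Q [_ /= s01]; exact: Q.
- by move=> x /=; rewrite H0.
- by move=> x /=; rewrite H1.
Qed.

Lemma homotopy_equiv_comp (X Y Z : topologicalType) (f : X -> Y) (g : Y -> Z) :
  is_homotopy_equiv f -> is_homotopy_equiv g -> is_homotopy_equiv (g \o f).
Proof.
move=> [cf [f' [cf' f'f ff']]] [cg [g' [cg' g'g gg']]]; split.
  by move=> x; apply: continuous_comp; [exact: cf|exact: cg].
exists (f' \o g'); split.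
- by move=> x; apply: continuous_comp; [exact: cg'|exact: cf'].
- apply: (@homotopic_trans _ _ (f' \o f)) => //.
  exact: (homotopic_compl cf' (homotopic_compr cf g'g)).
- apply: (@homotopic_trans _ _ (g \o g')) => //.
  exact: (homotopic_compl cg (homotopic_compr cg' ff')).
Qed.

End Homotopy.

(* Finite multigraphs with loops; the orientation of an edge only serves to
   parametrize it. *)
Record multigraph (V E : finType) := Multigraph {
  source : {ffun E -> V};
  target : {ffun E -> V}
}.

Section Multigraph.
Context (V E : finType) (G : multigraph V E).

Definition adjacent (S : {set E}) : rel V := fun u v =>
  [exists e in S, ((source G e == u) && (target G e == v)) ||
                  ((source G e == v) && (target G e == u))].

Definition connected_by (S : {set E}) : bool :=
  (0 < #|V|)%N && [forall u, forall v, connect (adjacent S) u v].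

Definition connected_graph : bool := connected_by [set: E].

Definition separating_edge (e : E) : bool := ~~ connected_by [set~ e].

(* A loop contributes 2. *)
Definition valence (v : V) : nat :=
  (#|[set e | source G e == v]| + #|[set e | target G e == v]|)%N.

(* A subgraph is given by its set of vertices and its set of edges. *)
Definition is_subgraph (W : {set V}) (S : {set E}) : bool :=
  [forall e in S, (source G e \in W) && (target G e \in W)].

Lemma subgraph_source W S (WS : is_subgraph W S) (e : {e : E | e \in S}) :
  source G (val e) \in W.
Proof. by have /forall_inP/(_ _ (valP e))/andP[] := WS. Qed.

Lemma subgraph_target W S (WS : is_subgraph W S) (e : {e : E | e \in S}) :
  target G (val e) \in W.
Proof. by have /forall_inP/(_ _ (valP e))/andP[] := WS. Qed.

Definition subgraph W S (WS : is_subgraph W S) :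
    multigraph {v : V | v \in W} {e : E | e \in S} :=
  {| source := [ffun e => exist _ (source G (val e)) (subgraph_source WS e)];
     target := [ffun e => exist _ (target G (val e)) (subgraph_target WS e)] |}.

End Multigraph.

(* The topological space underlying a graph: its points are the vertices and,
   for each edge, the points of an open unit interval. *)
Definition realization (R : realType) (V E : finType) (G : multigraph V E) :
  Type := (V + E * {t : R | 0 < t < 1})%type.

Section Realization.
Context (R : realType) (V E : finType) (G : multigraph V E).

HB.instance Definition _ := Choice.copy (realization R G)
  (V + E * {t : R | 0 < t < 1})%type.

(* The characteristic map of the closed edge e on [0, 1], extended to R by
   constants. *)
Definition edge_point (e : E) (t : R) : realization R G :=
  match insub t : option {t : R | 0 < t < 1} with
  | Some s => inr (e, s)
  | None => inl (if t <= 0 then source G e else target G e)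
  end.

(* The CW (quotient) topology. *)
Definition realization_open (U : set (realization R G)) : Prop :=
  forall e, open (edge_point e @^-1` U).

Let realization_openT : realization_open setT.
Proof. by move=> e; rewrite preimage_setT; exact: openT. Qed.

Let realization_openI : setI_closed realization_open.
Proof. by move=> A B oA oB e; rewrite preimage_setI; exact: openI. Qed.

Let realization_open_bigcup (I : Type) (f : I -> set (realization R G)) :
  (forall i, realization_open (f i)) -> realization_open (\bigcup_i f i).
Proof.
by move=> fo e; rewrite preimage_bigcup; apply: bigcup_open => i _; exact: fo.
Qed.

HB.instance Definition _ := isOpenTopological.Build (realization R G)
  realization_openT realization_openI realization_open_bigcup.

(* The path metric of the metric graph (G, l): the distance is the infimum of
   the lengths of the piecewise linear paths, a linear piece (e, s, t) going
   from edge_point e s to edge_point e t inside the closed edge e. *)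
Fixpoint is_pl_path (p q : realization R G) (c : seq (E * R * R)) : Prop :=
  if c is (e, s, t) :: c' then
    [/\ 0 <= s <= 1, 0 <= t <= 1, p = edge_point e s &
        is_pl_path (edge_point e t) q c']
  else p = q.

Definition pl_length (l : E -> R) (c : seq (E * R * R)) : R :=
  \sum_(x <- c) l x.1.1 * `|x.1.2 - x.2|.

Definition path_dist (l : E -> R) (p q : realization R G) : R :=
  inf [set pl_length l c | c in is_pl_path p q].

End Realization.

Definition is_isometry (R : realType) (V E V' E' : finType)
    (G : multigraph V E) (l : E -> R) (G' : multigraph V' E') (l' : E' -> R)
    (f : realization R G -> realization R G') : Prop :=
  [/\ continuous f,
      exists g : realization R G' -> realization R G,
        [/\ continuous g, cancel f g & cancel g f]
    & forall p q, path_dist l' (f p) (f q) = path_dist l p q].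

(* The wedge of n circles. *)
Definition rose (n : nat) : multigraph unit 'I_n :=
  {| source := [ffun=> tt]; target := [ffun=> tt] |}.

Notation rose_space R n := (realization R (rose n)).

(* Marked graphs (G, h) of rank n. Up to isomorphism a finite graph has
   vertices 0, ..., v-1 and edges 0, ..., k-1. The condition that pi_1(G) be
   free of rank n is carried by the homotopy equivalence to the rose. *)
Record marked_graph (R : realType) (n : nat) := MarkedGraph {
  mg_nv : nat;
  mg_ne : nat;
  mg_graph : multigraph 'I_mg_nv 'I_mg_ne;
  mg_marking : realization R mg_graph -> rose_space R n;
  mg_connected : connected_graph mg_graph;
  mg_valence :
    forall v, valence mg_graph v <> 1%N /\ valence mg_graph v <> 2%N;
  mg_nonsep : forall e, ~~ separating_edge mg_graph e;
  mg_equiv : is_homotopy_equiv R mg_marking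
}.

Arguments mg_marking {R n} m _.

Record marked_metric_graph (R : realType) (n : nat) := MarkedMetricGraph {
  mm_graph :> marked_graph R n;
  mm_length : 'rV[R]_(mg_ne mm_graph);
  mm_length_gt0 : forall e, 0 < mm_length 0 e;
  mm_length_sum : \sum_e mm_length 0 e = 1
}.

Section OuterSpace.
Context (R : realType) (n : nat).
Local Notation mmg := (marked_metric_graph R n).

Definition mm_equiv (A B : mmg) : Prop :=
  exists f : realization R (mg_graph A) -> realization R (mg_graph B),
    is_isometry (fun e => mm_length A 0 e) (fun e => mm_length B 0 e) f /\
    homotopic R (mg_marking B \o f) (mg_marking A).

Definition os_class (A : mmg) : set mmg := [set B | mm_equiv A B].

Definition outer_space : set (set mmg) := range os_class.

(* The open simplex of (G, h). *)
Definition os_simplex (M : marked_graph R n) : set (set mmg) :=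
  os_class @` [set A : mmg | mm_graph A = M].

(* The open d-simplices of outer space. *)
Definition os_simplices (d : nat) : set (set (set mmg)) :=
  os_simplex @` [set M | mg_ne M = d.+1].

(* Representatives of the elements of Out(F_n). *)
Definition rose_equiv : Type :=
  {phi : rose_space R n -> rose_space R n | is_homotopy_equiv R phi}.

Definition act_marked (phi : rose_equiv) (M : marked_graph R n) :
    marked_graph R n :=
  {| mg_connected := @mg_connected _ _ M;
     mg_valence := @mg_valence _ _ M;
     mg_nonsep := @mg_nonsep _ _ M;
     mg_equiv := homotopy_equiv_comp (@mg_equiv _ _ M) (proj2_sig phi) |}.

Definition act_metric (phi : rose_equiv) (A : mmg) : mmg :=
  @MarkedMetricGraph R n (act_marked phi A) (mm_length A)
    (@mm_length_gt0 _ _ A) (@mm_length_sum _ _ A).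

(* phi maps the class of (G, l, h) to the class of (G, l, phi \o h). *)
Definition out_act (phi : rose_equiv) (p : set mmg) : set mmg :=
  \bigcup_(A in p) os_class (act_metric phi A).

Definition out_orbit (sigma : set (set mmg)) : set (set (set mmg)) :=
  [set out_act phi @` sigma | phi in [set: rose_equiv]].

End OuterSpace.

Arguments outer_space : clear implicits.
Arguments os_simplices : clear implicits.

Section Metric.
Context (R : realType) (eps : R) (lam : R -> R).

(* The function t |-> lam t through which l_eps depends on l. *)
Definition is_cutoff : Prop :=
  [/\ forall t, 0 < t -> 0 < lam t,
      forall (k : nat) (t : R), 0 < t -> derivable (derive1n k lam) t 1,
      forall t, 2 * eps <= t -> lam t = eps &
      forall t, 0 < t -> t <= eps -> lam t = t].

Section Graph.
Context (V : finType) (k : nat) (G : multigraph V 'I_k).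

Definition is_cycle (sigma : {set V} * {set 'I_k}) : Prop :=
  exists WS : is_subgraph G sigma.1 sigma.2,
    [/\ connected_graph (subgraph WS),
        forall e, ~~ separating_edge (subgraph WS) e
      & homotopy_equivalent R (realization R (subgraph WS)) (rose_space R 1)].

Definition cycle_length (sigma : {set V} * {set 'I_k}) (x : 'rV[R]_k) : R :=
  \sum_(e in sigma.2) x 0 e.

Definition cycle_length_eps (sigma : {set V} * {set 'I_k}) (x : 'rV[R]_k) : R :=
  lam (cycle_length sigma x).

(* The bilinear form ds_eps^2 at x. *)
Definition ds2 (x u v : 'rV[R]_k) : R :=
  \sum_i u 0 i * v 0 i +
  \sum_(sigma | `[< is_cycle sigma >] && (cycle_length sigma x < 2 * eps))
    ('D_u (cycle_length_eps sigma) x / cycle_length_eps sigma x) *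
    ('D_v (cycle_length_eps sigma) x / cycle_length_eps sigma x).

(* For k = 3: the chart (s, t) |-> (s, t, 1 - s - t) of the open 2-simplex,
   and its coordinate vector fields. *)
Definition chart (p : R * R) : 'rV[R]_k :=
  \row_i [:: p.1; p.2; 1 - p.1 - p.2]`_i.

Definition chart_vector (j : 'I_2) : 'rV[R]_k :=
  \row_i (if j == 0 then [:: 1; 0; -1] else [:: 0; 1; -1])`_i.

Definition chart_domain : set (R * R) :=
  [set p | [/\ 0 < p.1, 0 < p.2 & p.1 + p.2 < 1]].

(* The Riemannian volume, the integral of the square root of the Gram
   determinant. *)
Definition graph_volume : \bar R :=
  (\int[lebesgue_measure \x lebesgue_measure]_(p in chart_domain)
     (Num.sqrt (\det (\matrix_(i < 2, j < 2)
        ds2 (chart p) (chart_vector i) (chart_vector j))))%:E)%E.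

End Graph.

(* A 2-simplex only determines (G, h) up to isomorphism, and all the simplices
   in an orbit are isometric: the suprema below are over constant families. *)
Definition simplex_volume (n : nat)
    (sigma : set (set (marked_metric_graph R n))) : \bar R :=
  ereal_sup [set graph_volume (mg_graph M) | M in
    [set M : marked_graph R n | mg_ne M = 3%N /\ os_simplex M = sigma]].

(* The top-dimensional simplices of X_2 are those of dimension 2. *)
Definition quotient_volume : \bar R :=
  (\esum_(O in out_orbit (n:=2) @` os_simplices R 2 2)
     ereal_sup [set simplex_volume sigma | sigma in O])%E.

End Metric.

(* Main.v *)
Require Import Defs.
From mathcomp Require Import all_boot all_order all_algebra.
From mathcomp Require Import zify ring lra.
From mathcomp Require Import all_classical all_reals all_analysis.
From mathcomp Require Import measurable_realfun.

Set Implicit Arguments.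
Unset Strict Implicit.
Unset Printing Implicit Defensive.

Import Order.TTheory GRing.Theory Num.Theory.
Import numFieldNormedType.Exports.

Local Open Scope classical_set_scope.
Local Open Scope ring_scope.

(** Finiteness of the volume rests on the fact that a marked graph of rank 2
with three edges is a theta graph. An Euler characteristic count on valences
leaves only two other candidates. The dumbbell has a separating edge. The
bouquet of three circles must be excluded by topology, and this is essential:
two of its loops can be short independently of each other, and the volume of
its simplex is infinite. It is not homotopy equivalent to the bouquet of two
circles because maps to the circle R/Z are classified up to homotopy by their
degrees on the loops: if g and f are maps between bouquets of m and n circles
such that g \o f is homotopic to the identity, the degree matrices of g and f
are an m x n matrix and an n x m matrix whose product is the identity, so that
m <= n ([bouquet_retract_rank]).

In a theta graph with edge lengths a, b, c and a + b + c = 1, a cycle consists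
of two edges, and two different cycles have total length more than 1. As
4 eps < 1, at most one cycle is short at any given point, so that the metric
is there the flat one plus a single rank one term (dl/l)^2, up to a bounded
factor where lam differs from the identity ([ds2_rank_one]). The Gram
determinant is then O(1/l^2) and the volume element is O(1/l)
([gram_sqrt_le]). Since l = 1 - x with x the length of the edge outside the
cycle, l vanishes only at a vertex of the triangle, and 1/l is integrable over
a triangle near a vertex ([triangle_integral_le]).

This bounds the volumes of all the 2-simplices by the same constant. For the
quotient it remains to see that there are finitely many orbits: two markings of
the same graph differ by a self homotopy equivalence of the rose, hence the
orbit of a simplex depends only on its underlying graph, and there are finitely
many graphs with two vertices and three edges ([finite_theta_orbits]). *)

(** * Real functions that are continuous modulo 1 *)
Section Mod1.
Context (R : realType).

(** The representative of x modulo 1 in [-1/2, 1/2); its absolute value is the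
distance from x to the nearest integer. *)
Definition res1 (x : R) : R := x - (Num.floor (x + 2^-1))%:~R.

Lemma res1_itv (x : R) : - 2^-1 <= res1 x < 2^-1.
Proof.
have /andP[] := floor_itv (x + 2^-1); rewrite intrD /= => h1 h2.
by apply/andP; split; rewrite /res1; lra.
Qed.

Lemma res1_congr (x : R) : x - res1 x \is a Num.int.
Proof. by rewrite /res1 opprB addrC subrK intr_int. Qed.

Lemma int_lt1_eq0 (z : R) : z \is a Num.int -> `|z| < 1 -> z = 0.
Proof.
move=> /intrP[m ->]; rewrite -intr_norm -[1]/(1%:~R) ltr_int => m1.
by have -> : m = 0 by lia.
Qed.

Lemma res1_unique (x y : R) : x - y \is a Num.int -> `|y| < 2^-1 -> res1 x = y.
Proof.
move=> xy /ltr_normlP[y1 y2]; apply/eqP; rewrite -subr_eq0; apply/eqP.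
have /andP[r1 r2] := res1_itv x.
apply: int_lt1_eq0; last by apply/ltr_normlP; split; lra.
by have := rpredB xy (res1_congr x); rewrite opprB addrC addrA subrK.
Qed.

Lemma norm_res1_le (x y : R) : x - y \is a Num.int -> `|res1 x| <= `|y|.
Proof.
move=> xy; have [y2|y2] := ltP `|y| 2^-1; first by rewrite (res1_unique xy).
have /andP[r1 r2] := res1_itv x.
by apply: le_trans y2; apply/ler_normlP; split; lra.
Qed.

Lemma norm_res1_congr (x y : R) : x - y \is a Num.int -> `|res1 x| = `|res1 y|.
Proof.
move=> xy; apply/eqP; rewrite eq_le; apply/andP; split; apply: norm_res1_le.
  by have := rpredD xy (res1_congr y); rewrite addrA subrK.
have := rpredD (_ : y - x \is a Num.int) (res1_congr x).
by rewrite addrA subrK; apply; rewrite -opprB rpredN.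
Qed.

Lemma norm_res1D (x y : R) : `|res1 (x + y)| <= `|res1 x| + `|res1 y|.
Proof.
apply: le_trans (ler_normD _ _); apply: norm_res1_le.
by rewrite opprD addrACA rpredD ?res1_congr.
Qed.

Lemma norm_res1N (x : R) : `|res1 (- x)| = `|res1 x|.
Proof.
have H (y : R) : `|res1 (- y)| <= `|res1 y|.
  rewrite -[leRHS]normrN; apply: norm_res1_le.
  by rewrite -opprD rpredN res1_congr.
by apply/eqP; rewrite eq_le H /= -{1}(opprK x) H.
Qed.

Lemma norm_res1Ml (x y : R) : y \is a Num.int ->
  `|res1 (y * x)| <= `|y| * `|res1 x|.
Proof.
move=> yint; rewrite -normrM; apply: norm_res1_le.
by rewrite -mulrBr rpredM ?res1_congr.
Qed.

(** A map to the circle R/Z is represented by an arbitrary real lift; continuity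
is that of the class modulo 1. *)
Definition continuous_mod1 (X : topologicalType) (u : X -> R) : Prop :=
  forall (x : X) (e : R), 0 < e -> \forall y \near x, `|res1 (u y - u x)| < e.

Section Topological.
Context (X Y : topologicalType).
Implicit Types u v : X -> R.

Lemma continuous_is_mod1 u : continuous u -> continuous_mod1 u.
Proof.
move=> cu x e e0; have /cvgrPdist_lt/(_ _ e0) := cu x.
apply: filterS => y yx; apply: le_lt_trans yx.
by rewrite (distrC (u x)); apply: norm_res1_le; rewrite subrr.
Qed.

Lemma continuous_mod1_comp (g : Y -> X) u :
  continuous g -> continuous_mod1 u -> continuous_mod1 (u \o g).
Proof. by move=> cg cu x e e0; exact: (cg x _ (cu (g x) e e0)). Qed.

Lemma continuous_mod1_congr u v :
  (forall x, u x - v x \is a Num.int) -> continuous_mod1 v -> continuous_mod1 u.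
Proof.
move=> uv cv x e e0; near=> y.
rewrite (@norm_res1_congr _ (v y - v x)); first by near: y; exact: cv.
rewrite (_ : _ - _ = (u y - v y) - (u x - v x)); last lra.
exact: rpredB.
Unshelve. all: by end_near. Qed.

Lemma continuous_mod1D u v : continuous_mod1 u -> continuous_mod1 v ->
  continuous_mod1 (fun x => u x + v x).
Proof.
move=> cu cv x e e0; have e2 : 0 < e / 2 by rewrite divr_gt0.
near=> y; have -> : u y + v y - (u x + v x) = (u y - u x) + (v y - v x) by lra.
apply: le_lt_trans (norm_res1D _ _) _; rewrite [e]splitr; apply: ltrD.
  by near: y; exact: cu.
by near: y; exact: cv.
Unshelve. all: by end_near. Qed.

Lemma continuous_mod1Ml (a : R) u : a \is a Num.int -> continuous_mod1 u ->
  continuous_mod1 (fun x => a * u x).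
Proof.
move=> aint cu x e e0; have a1 : 0 < `|a| + 1 by rewrite ltr_wpDl.
near=> y.
have : `|res1 (u y - u x)| < e / (`|a| + 1).
  by near: y; exact: (cu x _ (divr_gt0 e0 a1)).
rewrite -mulrBr ltr_pdivlMr// => H; apply: le_lt_trans H.
apply: le_trans (norm_res1Ml _ aint) _; rewrite mulrC ler_wpM2l//.
by rewrite lerDl.
Unshelve. all: by end_near. Qed.

Lemma continuous_mod1N u :
  continuous_mod1 u -> continuous_mod1 (fun x => - u x).
Proof.
move=> cu x e e0; near=> y.
by rewrite -opprD norm_res1N; near: y; exact: cu.
Unshelve. all: by end_near. Qed.

Lemma continuous_mod1B u v : continuous_mod1 u -> continuous_mod1 v ->
  continuous_mod1 (fun x => u x - v x).
Proof. by move=> cu /continuous_mod1N; exact: continuous_mod1D. Qed.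

(** Away from the half integers, [res1] is a local inverse of the projection of
R onto R/Z, so it turns continuity modulo 1 into continuity. *)
Lemma continuous_res1 u :
  continuous_mod1 u -> (forall x, `|res1 (u x)| < 4^-1) ->
  continuous (res1 \o u).
Proof.
move=> cu u4 x; apply/cvgrPdist_lt => e e0.
near=> y; rewrite (distrC (res1 (u x))) /=.
rewrite -(@res1_unique (u y - u x) (res1 (u y) - res1 (u x))).
- by near: y; exact: cu.
- rewrite (_ : _ - _ = (u y - res1 (u y)) - (u x - res1 (u x))); last lra.
  by rewrite rpredB ?res1_congr.
- apply: le_lt_trans (ler_normB _ _) _.
  by have := u4 x; have := u4 y; lra.
Unshelve. all: by end_near. Qed.

End Topological.

Lemma continuous_int_const (V : R -> R) : continuous V ->
  (forall t, 0 <= t <= 1 -> V t \is a Num.int) -> V 0 = V 1.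
Proof.
move=> cV Vint; apply/eqP; apply/negP => /negP V01.
pose v := Num.min (V 0) (V 1) + 2^-1.
have i0 : V 0 \is a Num.int by apply: Vint; rewrite lexx ler01.
have i1 : V 1 \is a Num.int by apply: Vint; rewrite lexx ler01.
have gap (x y : R) : x \is a Num.int -> y \is a Num.int -> x < y -> x + 1 <= y.
  move=> /intrP[a ->] /intrP[b ->]; rewrite ltr_int => ab.
  by rewrite -[1]/(1%:~R) -intrD ler_int lezD1.
have [|t t01] := @IVT R V 0 1 v ler01 (continuous_subspaceT cV).
  rewrite /v /Num.min /Num.max; case: ltgtP V01 => // h _.
    by have := gap _ _ i0 i1 h; lra.
  by have := gap _ _ i1 i0 h; lra.
rewrite in_itv /= in t01; move=> Vtv.
have := Vint t t01; rewrite Vtv /v => vi.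
have : (2^-1 : R) \is a Num.int.
  have mi : Num.min (V 0) (V 1) \is a Num.int by rewrite /Num.min; case: ifP.
  by have := rpredB vi mi; rewrite addrC addKr.
move=> /int_lt1_eq0; rewrite ger0_norm ?invr_ge0//; lra.
Qed.

End Mod1.

(** * Lifting maps from an interval or a square *)
Section Lift.
Context (R : realType).

Definition clamp01 (t : R) : R := Num.max 0 (Num.min 1 t).

Lemma clamp01_itv t : 0 <= clamp01 t <= 1.
Proof.
by rewrite /clamp01 le_max lexx /= ge_max ler01 ge_min lexx.
Qed.

Lemma clamp01_id t : 0 <= t <= 1 -> clamp01 t = t.
Proof. by move=> /andP[t0 t1]; rewrite /clamp01 min_r// max_r. Qed.

Lemma clamp01_le0 t : t <= 0 -> clamp01 t = 0.
Proof.
by move=> t0; rewrite /clamp01 min_r ?max_l// (le_trans t0)// ler01.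
Qed.

Lemma clamp01_ge1 t : 1 <= t -> clamp01 t = 1.
Proof. by move=> t0; rewrite /clamp01 min_l// max_r. Qed.

Lemma clamp01_continuous : continuous clamp01.
Proof.
move=> t; apply: continuous_max; first exact: cst_continuous.
apply: continuous_min; [exact: cst_continuous|exact: cvg_id].
Qed.

Let square : set (R * R) := `[0, 1] `*` `[0, 1].

(** By compactness of the square. *)
Lemma mod1_uniform (U : R * R -> R) : continuous_mod1 U ->
  exists n : nat, forall p q : R * R, square p -> ball p n.+1%:R^-1 q ->
    `|res1 (U q - U p)| < 4^-1.
Proof.
move=> cU; have : compact square by apply: compact_setX; exact: segment_compact.
move=> /compact_near_coveringP/(_ nat \oo
  (fun n p => forall q, ball p n.+1%:R^-1 q -> `|res1 (U q - U p)| < 4^-1)).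
case=> [p _|n _ H]; last by exists n => p q Sp; apply: (H n) => /=.
have e8 : 0 < 8^-1 :> R by rewrite invr_gt0.
have [d /= d0 Hd] := (nbhs_ballP _ _).1 (cU p _ e8).
have d2 : 0 < d / 2 by rewrite divr_gt0.
near=> q n => /= q' qq'.
have pq : ball p (d / 2) q by near: q; exact: nbhsx_ballx.
have nd : n.+1%:R^-1 < d / 2 by near: n; exact: near_infty_natSinv_lt (PosNum d2).
have -> : U q' - U q = (U q' - U p) + - (U q - U p) by lra.
apply: le_lt_trans (norm_res1D _ _) _; rewrite norm_res1N.
have h1 : `|res1 (U q - U p)| < 8^-1.
  apply: Hd; apply: le_ball pq.
  by rewrite ler_pdivrMr// ler_peMr// ?ltW// ltr1n.
have h2 : `|res1 (U q' - U p)| < 8^-1.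
  apply: Hd; rewrite [d]splitr; apply: ball_triangle pq _.
  exact: le_ball (ltW nd) _ qq'.
by lra.
Unshelve. all: by end_near. Qed.

(** Radial lifting: the square is star-shaped, so V (p) can be obtained by
following U along the segment from (0, 0) to p. Cutting every such segment into
N equal pieces, with N given by uniform continuity, makes all the increments of
U less than 1/4 modulo 1, and their representatives add up to a function that
is continuous in p and congruent to U modulo 1. *)
Lemma mod1_lift2 (U : R * R -> R) : continuous_mod1 U ->
  exists2 V : R * R -> R, continuous V &
    forall s t, 0 <= s <= 1 -> 0 <= t <= 1 -> V (s, t) - U (s, t) \is a Num.int.
Proof.
move=> cU; have [n Hn] := mod1_uniform cU.
(* One more than the n.+1 of uniform continuity, whose balls are open. *)
pose N : R := n.+2%:R.
pose P k (p : R * R) := (k%:R / N * clamp01 p.1, k%:R / N * clamp01 p.2).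
have N0 : 0 < N by rewrite ltr0n.
have cP k : continuous (P k).
  move=> p.
  apply: (@cvg_pair _ _ _ (nbhs p) (nbhs (k%:R / N * clamp01 p.1))
                          (nbhs (k%:R / N * clamp01 p.2))).
    apply: cvgM; first exact: cvg_cst.
    by apply: continuous_comp; [exact: cvg_fst|exact: clamp01_continuous].
  apply: cvgM; first exact: cvg_cst.
  by apply: continuous_comp; [exact: cvg_snd|exact: clamp01_continuous].
pose W k p := U (P k.+1 p) - U (P k p).
have cW k : continuous_mod1 (W k).
  by apply: continuous_mod1B; apply: (continuous_mod1_comp (@cP _) cU).
have step (k : nat) (a : R) : (k < n.+2)%N -> 0 <= a <= 1 ->
    0 <= k%:R / N * a <= 1 /\ `|k%:R / N * a - k.+1%:R / N * a| < n.+1%:R^-1.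
  move=> kn /andP[a0 a1]; have k0 : 0 <= k%:R / N by rewrite divr_ge0// ltW.
  have k1 : k%:R / N <= 1 by rewrite ler_pdivrMr// mul1r ler_nat ltnW.
  split; first by rewrite mulr_ge0//= mulr_ile1.
  rewrite distrC -mulrBl -mulrBl -natrB// subSnn mul1r normrM.
  rewrite ger0_norm ?invr_ge0 ?(ltW N0)//.
  rewrite (ger0_norm a0); apply: (@le_lt_trans _ _ N^-1).
    by rewrite ler_piMr// invr_ge0 ltW.
  by rewrite ltf_pV2 ?posrE ?ltr0n// ltr_nat.
have W4 k p : (k < n.+2)%N -> `|res1 (W k p)| < 4^-1.
  move=> kn; have [a0 a1] := step k _ kn (clamp01_itv p.1).
  have [b0 b1] := step k _ kn (clamp01_itv p.2).
  by apply: Hn; split => //=; rewrite in_itv.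
have P0 p : P 0%N p = (0, 0) by rewrite /P !mul0r.
exists (fun p => U (0, 0) + \sum_(k < n.+2) res1 (W k p)).
  move=> p; apply: cvgD.
    exact: cvg_cst.
  apply: cvg_big => [|k _]; first exact: add_continuous.
  apply: (continuous_res1 (u := W k)); first exact: cW.
  by move=> q; exact: W4.
move=> s t s01 t01.
have -> : U (s, t) = U (P n.+2 (s, t)).
  by rewrite /P /= !clamp01_id// divff ?gt_eqF// !mul1r.
have -> : U (P n.+2 (s, t)) = U (0, 0) + \sum_(k < n.+2) W k (s, t).
  rewrite -(big_mkord xpredT (fun k => W k (s, t))) telescope_sumr//.
  by rewrite P0 addrC subrK.
rewrite opprD addrACA subrr add0r -sumrB rpred_sum// => k _.
by rewrite -opprB rpredN res1_congr.
Qed.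

Lemma mod1_lift (u : R -> R) : continuous_mod1 u ->
  exists2 v : R -> R, continuous v &
    forall t, 0 <= t <= 1 -> v t - u t \is a Num.int.
Proof.
move=> cu.
have [|V cV VU] := @mod1_lift2 (u \o fst).
  by apply: continuous_mod1_comp cu => p; exact: cvg_fst.
exists (fun t => V (t, 0)); last first.
  by move=> t t01; apply: VU => //; rewrite lexx ler01.
move=> t; apply: (@continuous_comp _ _ _ (fun t => (t, 0)) V); last exact: cV.
apply: (@cvg_pair _ _ _ (nbhs t) (nbhs t) (nbhs (0 : R))).
  exact: cvg_id.
exact: cvg_cst.
Qed.

End Lift.

(** * Maps on the realization of a graph *)
Section Realization.
Context (R : realType) (V E : finType) (G : multigraph V E).
Local Notation X := (realization R G).

Lemma open_realization (A : set X) : open A = realization_open A.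
Proof. by []. Qed.

Lemma edge_point_continuous e : continuous (@edge_point R V E G e).
Proof. by apply/continuousP => A; rewrite open_realization; exact. Qed.

Lemma edge_point_source e t :
  t <= 0 -> @edge_point R V E G e t = inl (source G e).
Proof.
move=> t0; rewrite /edge_point insubN ?t0//.
by rewrite negb_and -leNgt t0.
Qed.

Lemma edge_point_target e t :
  1 <= t -> @edge_point R V E G e t = inl (target G e).
Proof.
move=> t1; rewrite /edge_point insubN ?lt_geF ?(lt_le_trans ltr01)//.
by rewrite negb_and -!leNgt t1 orbT.
Qed.

Lemma edge_point_inner e (s : {t : R | 0 < t < 1}) :
  @edge_point R V E G e (val s) = inr (e, s).
Proof. by rewrite /edge_point valK. Qed.

Lemma continuous_realization (Y : topologicalType) (f : X -> Y) :
  (forall e, continuous (fun t => f (@edge_point R V E G e t))) -> continuous f.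
Proof.
move=> cf; apply/continuousP => A oA; rewrite open_realization => e.
by have /continuousP/(_ A oA) := cf e.
Qed.

Lemma continuous_mod1_realization (u : X -> R) :
  (forall e, continuous_mod1 (fun t => u (@edge_point R V E G e t))) ->
  continuous_mod1 u.
Proof.
move=> cu x e e0.
pose A := [set y : X | `|res1 (u y - u x)| < e].
have oA : open A.
  rewrite open_realization => d; rewrite openE => t /= At.
  have d0 : 0 < e - `|res1 (u (edge_point G d t) - u x)| by rewrite subr_gt0.
  apply: filterS (cu d t _ d0) => s; rewrite /A /= ltrBrDr => H.
  apply: le_lt_trans H; apply: le_trans (norm_res1D _ _).
  by rewrite addrA subrK.
apply: open_nbhs_nbhs; split => //.
by rewrite /A /= subrr (@res1_unique _ _ 0) ?normr0// ?subrr ?rpred0// invr_gt0.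
Qed.

End Realization.

(** * Maps from a bouquet of circles to the circle *)
Section Bouquet.
Context (R : realType) (V : finType) (n : nat) (G : multigraph V 'I_n) (v0 : V).
Hypothesis V1 : forall v, v = v0.
Local Notation X := (realization R G).

(** The collapse of all the circles but the i-th one, as a map to R/Z. *)
Definition winding (i : 'I_n) (x : X) : R :=
  match x with inl _ => 0 | inr (e, s) => if e == i then val s else 0 end.

Lemma winding_edge i e t :
  winding i (edge_point G e t) - (e == i)%:R * clamp01 t \is a Num.int.
Proof.
have [t0|t0] := leP t 0.
  by rewrite edge_point_source//= clamp01_le0// mulr0 subrr.
have [t1|t1] := leP 1 t.
  by rewrite edge_point_target//= clamp01_ge1// mulr1 sub0r rpredN natr_int.
have tP : 0 < t < 1 by rewrite t0 t1.
rewrite -[t]/(val (exist _ t tP : {t : R | 0 < t < 1})) edge_point_inner /=.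
rewrite clamp01_id ?ltW//.
by case: eqP => _; rewrite ?mul1r ?mul0r subrr.
Qed.

Lemma winding_continuous i : continuous_mod1 (winding i).
Proof.
apply: continuous_mod1_realization => e.
apply: (continuous_mod1_congr (winding_edge i e)).
apply: continuous_mod1Ml; first exact: natr_int.
apply: continuous_is_mod1; exact: clamp01_continuous.
Qed.

Lemma edge_point_ends e : edge_point G e 1 = edge_point G e 0 :> X.
Proof.
rewrite (edge_point_source _ _ (lexx 0)) (edge_point_target _ _ (lexx 1)).
by rewrite (V1 (source _ _)) (V1 (target _ _)).
Qed.

(** Every map u from a bouquet to the circle differs from an integral
combination of the maps [winding j] by a map with a real lift: take for D j
the degree of u on the j-th loop. The difference then has degree 0 on each
loop, so its lifts along the edges close up to a function on the bouquet. *)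
Lemma mod1_bouquet (u : X -> R) : continuous_mod1 u ->
  exists2 D : 'I_n -> R, forall j, D j \is a Num.int &
  exists2 w : X -> R, continuous w &
    forall x, u x - (\sum_j D j * winding j x + w x) \is a Num.int.
Proof.
move=> cu.
have lift e : exists v : R -> R, continuous v /\
    forall t, 0 <= t <= 1 -> v t - u (edge_point G e t) \is a Num.int.
  have [v ? ?] := mod1_lift
    (continuous_mod1_comp (@edge_point_continuous R _ _ G e) cu).
  by exists v.
have [v /all_and2[cv vu]] := choice lift.
pose D j := v j 1 - v j 0.
have Dint j : D j \is a Num.int.
  rewrite /D (_ : _ - _ = (v j 1 - u (edge_point G j 1)) -
                          (v j 0 - u (edge_point G j 0))).
    by rewrite rpredB ?vu ?lexx ?ler01.
  by rewrite edge_point_ends; lra.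
exists D => //.
pose c := u (inl v0).
pose W e t := v e (clamp01 t) - v e 0 - D e * clamp01 t + c.
pose w (x : X) := match x with inl _ => c | inr (e, s) => W e (val s) end.
have w_edge e t : w (edge_point G e t) = W e t.
  have [t0|t0] := leP t 0.
    by rewrite edge_point_source//= /W clamp01_le0//; lra.
  have [t1|t1] := leP 1 t.
    by rewrite edge_point_target//= /W clamp01_ge1// mulr1 /D; lra.
  have tP : 0 < t < 1 by rewrite t0 t1.
  rewrite -[t]/(val (exist _ t tP : {t : R | 0 < t < 1})).
  by rewrite edge_point_inner.
exists w.
  apply: continuous_realization => e.
  rewrite (_ : (fun t => _) = W e); last by apply/funext => t; rewrite w_edge.
  move=> t; apply: cvgD; last exact: cvg_cst.
  apply: cvgB; last by apply: cvgM; [exact: cvg_cst|exact: clamp01_continuous].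
  apply: cvgB; last exact: cvg_cst.
  by apply: continuous_comp; [exact: clamp01_continuous|exact: cv].
case=> [x|[e s]].
  rewrite (V1 x) /= big1 ?add0r ?subrr// => i _; exact: mulr0.
rewrite /= (bigD1 e)//= eqxx big1 ?addr0; last first.
  by move=> i /negbTE ie; rewrite eq_sym ie mulr0.
have /andP[s0 s1] := valP s.
rewrite /W clamp01_id ?ltW//.
have h0 : v e 0 - c \is a Num.int.
  have := vu e 0; rewrite lexx ler01 edge_point_source// (V1 (source _ _)); exact.
have h1 : v e (val s) - u (inr (e, s)) \is a Num.int.
  by rewrite -edge_point_inner vu// !ltW.
rewrite (_ : _ - _ = (v e 0 - c) - (v e (val s) - u (inr (e, s)))).
  exact: rpredB.
by lra.
Qed.

End Bouquet.

(** Clamping the time extends a path of maps to the whole plane, where the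
lifting results apply. *)
Lemma continuous_clamp_homotopy (R : realType) (X Y : topologicalType)
    (H : X * R -> Y) (c : R -> X) :
  {within [set: X] `*` `[0, 1], continuous H} -> continuous c ->
  continuous (fun p : R * R => H (c p.1, clamp01 p.2)).
Proof.
move=> /subspace_continuousP cH cc p.
have Kp q : ([set: X] `*` `[0, 1]) (c q.1, clamp01 q.2 : R).
  by split => //=; rewrite in_itv; exact: clamp01_itv.
have := cH _ (Kp p); apply: cvg_trans => P /= HP.
rewrite /nbhs /= /within /=.
have cl : {for p, continuous (fun p : R * R => (c p.1, clamp01 p.2))}.
  apply: (@cvg_pair _ _ _ (nbhs p) (nbhs (c p.1)) (nbhs (clamp01 p.2))).
    by apply: continuous_comp; [exact: cvg_fst|exact: cc].
  by apply: continuous_comp; [exact: cvg_snd|exact: clamp01_continuous].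
have := cl _ HP; rewrite /nbhs /= => Q.
by apply: filterS Q => q /= Q; exact: Q (Kp q).
Qed.

(** A is the degree matrix of g and B that of f: A i j is the degree of
[winding i \o g] on the j-th loop, and B j k the degree of [winding j \o f] on
the k-th loop. The matrix of g \o f is A *m B because [winding i \o g] is, up to
a map with a real lift, the combination of the [winding j] with coefficients
A i j. Degrees are homotopy invariant, as integers depending continuously on
the time, so A *m B = 1%:M. *)
Theorem bouquet_retract_rank (R : realType) (V V' : finType) (m n : nat)
    (G : multigraph V 'I_m) (G' : multigraph V' 'I_n) (v0 : V) (v0' : V')
    (f : realization R G -> realization R G')
    (g : realization R G' -> realization R G) :
  (forall v, v = v0) -> (forall v, v = v0') ->
  continuous f -> continuous g -> homotopic R (g \o f) id -> (m <= n)%N.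
Proof.
move=> V1 V1' cf cg [H [cH H0 H1]].
have /choice[D HD] : forall i : 'I_m, exists D : 'I_n -> R,
    (forall j, D j \is a Num.int) /\
    exists2 w : realization R G' -> R, continuous w & forall x,
    winding i (g x) - (\sum_j D j * winding j x + w x) \is a Num.int.
  move=> i.
  have [D Dint [w cw Hw]] :=
    mod1_bouquet V1' (continuous_mod1_comp cg (@winding_continuous R _ _ G i)).
  by exists D; split => //; exists w.
pose c k := @edge_point R _ _ G k.
have cc k : continuous (c k) by exact: edge_point_continuous.
have /choice[L HL] : forall jk : 'I_n * 'I_m, exists L : R -> R, continuous L /\
    forall t, 0 <= t <= 1 -> L t - winding jk.1 (f (c jk.2 t)) \is a Num.int.
  case=> j k; have cfc : continuous (f \o c k).
    by move=> t; apply: continuous_comp; [exact: cc|exact: cf].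
  have [L ? ?] := mod1_lift
    (continuous_mod1_comp cfc (@winding_continuous R _ _ G' j)).
  by exists L.
pose A := \matrix_(i < m, j < n) D i j.
pose B := \matrix_(j < n, k < m) (L (j, k) 1 - L (j, k) 0).
apply: (@mulmx1_min _ _ _ A B); apply/matrixP => i k; rewrite !mxE.
under eq_bigr do rewrite !mxE.
have cU : continuous (fun p : R * R => H (c k p.1, clamp01 p.2)).
  exact: continuous_clamp_homotopy cH (cc k).
have [V2 cV VU] := mod1_lift2
  (continuous_mod1_comp cU (@winding_continuous R _ _ G i)).
have cVl t : continuous (fun s => V2 (s, t)).
  move=> s; apply: (@continuous_comp _ _ _ (fun s => (s, t)) V2); last exact: cV.
  by apply: (@cvg_pair _ _ _ (nbhs s) (nbhs s) (nbhs t));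
    [exact: cvg_id|exact: cvg_cst].
have cVr s : continuous (fun t => V2 (s, t)).
  move=> t; apply: (@continuous_comp _ _ _ (fun t => (s, t)) V2); last exact: cV.
  by apply: (@cvg_pair _ _ _ (nbhs t) (nbhs s) (nbhs t));
    [exact: cvg_cst|exact: cvg_id].
have i0 : 0 <= (0 : R) <= 1 by rewrite lexx ler01.
have i1 : 0 <= (1 : R) <= 1 by rewrite lexx ler01.
have c01 : c k 1 = c k 0 by exact: (edge_point_ends R G V1 k).
(* The degree on the k-th loop is an integer at every time, because the two
   ends of the loop stay together, and it depends continuously on the time. *)
have deg : V2 (1, 0) - V2 (0, 0) = V2 (1, 1) - V2 (0, 1).
  apply: (@continuous_int_const _ (fun t => V2 (1, t) - V2 (0, t))).
    by move=> t; apply: cvgB; exact: cVr.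
  move=> t t01; have := rpredB (VU 1 t i1 t01) (VU 0 t i0 t01).
  by rewrite /= c01 opprB addrA subrK.
have deg1 : V2 (1, 1) - V2 (0, 1) = (i == k)%:R.
  have : V2 (0, 1) - (k == i)%:R * clamp01 0 =
         V2 (1, 1) - (k == i)%:R * clamp01 1.
    apply: (@continuous_int_const _
      (fun s => V2 (s, 1) - (k == i)%:R * clamp01 s)).
      move=> t; apply: cvgB; first exact: cVl.
      by apply: cvgM; [exact: cvg_cst|exact: clamp01_continuous].
    move=> s s01; have := VU s 1 s01 i1; rewrite /= (clamp01_id i1) H1 => h.
    have := rpredD h (winding_edge G i k s).
    by rewrite /c /= addrA subrK.
  rewrite !clamp01_id// eq_sym; lra.
rewrite -deg1 -deg.
have [Dint [w cw Hw]] := HD i.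
(* S is a lift of winding i \o g \o f along the k-th loop. *)
pose S s := \sum_j D i j * L (j, k) s + w (f (c k s)).
have deg0 : V2 (0, 0) - S 0 = V2 (1, 0) - S 1.
  apply: (@continuous_int_const _ (fun s => V2 (s, 0) - S s)).
    move=> t; apply: cvgB; first exact: cVl.
    apply: cvgD.
      apply: cvg_big => [|j _]; first exact: add_continuous.
      by apply: cvgM; [exact: cvg_cst|exact: (HL (j, k)).1].
    apply: (@continuous_comp _ _ _ (f \o c k) w); last exact: cw.
    by apply: continuous_comp; [exact: cc|exact: cf].
  move=> s s01; have := VU s 0 s01 i0; rewrite /= (clamp01_id i0) H0 => h.
  have h' := Hw (f (c k s)).
  have hL : \sum_j D i j * (L (j, k) s - winding j (f (c k s))) \is a Num.int.
    by apply: rpred_sum => j _; rewrite rpredM// (HL (j, k)).2.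
  move: hL; under eq_bigr do rewrite mulrBr.
  rewrite sumrB => hL; have := rpredB (rpredD h h') hL.
  rewrite /S /=; set a := \sum_j _; set b := \sum_j _.
  by rewrite (_ : _ - _ = V2 (s, 0) - (b + w (f (c k s))))//; lra.
have -> : V2 (1, 0) - V2 (0, 0) = S 1 - S 0 by lra.
rewrite /S c01 opprD addrACA subrr addr0 -sumrB; apply: eq_bigr => j _.
by rewrite mulrBr.
Qed.

(** * Graphs with three edges *)
Section Combinatorics.
Context (V E : finType) (G : multigraph V E).

Lemma connected_by_nonloop (S : {set E}) (u v : V) :
  connected_by G S -> u != v -> exists2 e, e \in S & source G e != target G e.
Proof.
move=> /andP[_ /forallP/(_ u)/forallP/(_ v)/connectP[p pth ->]] uv.
apply/exists_inP; apply: contraNT uv => /exists_inPn loops.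
elim: p u pth => [|x p IH] u //= /andP[/exists_inP[e eS He] pth].
suff -> : u = x by exact: IH.
have /negPn/eqP st := loops e eS.
by case/orP: He => /andP[/eqP <- /eqP <-]; rewrite st.
Qed.

Lemma valence_sum v :
  valence G v = (\sum_e ((source G e == v) + (target G e == v)))%N.
Proof.
rewrite big_split /= /valence.
have mem_card (A : set E) (P : pred E) : (forall e, A e <-> P e) ->
    #|A| = (\sum_e P e)%N.
  move=> AP; rewrite -sum1_card big_mkcond; apply: eq_bigr => e _.
  rewrite (_ : (e \in A) = P e); first by case: (P e).
  by apply/idP/idP => [/set_mem/AP|/AP/mem_set].
by congr (_ + _)%N; exact: mem_card.
Qed.

Lemma sum_valence : (\sum_v valence G v = 2 * #|E|)%N.
Proof.
under eq_bigr do rewrite valence_sum.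
rewrite exchange_big /= (eq_bigr (fun=> 2%N)) => [|e _].
  by rewrite sum_nat_const mulnC.
rewrite big_split /=; have H (w : V) : (\sum_v (w == v) = 1)%N.
  rewrite (bigD1 w)//= eqxx big1 ?addn0// => v /negbTE.
  by rewrite eq_sym => ->.
by rewrite !H.
Qed.

Lemma connected_valence_gt0 (u v : V) :
  connected_graph G -> u != v -> (0 < valence G u)%N.
Proof.
move=> /andP[_ /forallP/(_ u)/forallP/(_ v)/connectP[[|x p] /= pth ->]].
  by rewrite eqxx.
move=> _; case/andP: pth => /exists_inP[e _ He] _.
rewrite valence_sum (bigD1 e)//=.
by case/orP: He => /andP[/eqP -> /eqP ->]; rewrite !addn_gt0 eqxx ?orbT.
Qed.

End Combinatorics.

(** Removing the only edge of a subgraph would disconnect its two ends. *)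
Lemma cycle_not_one_edge (V E : finType) (G : multigraph V E)
    (W : {set V}) (S : {set E}) (WS : is_subgraph G W S) :
  (forall e, source G e != target G e) ->
  (forall e, ~~ separating_edge (subgraph WS) e) -> #|S| != 1%N.
Proof.
move=> noloop nonsep; apply/negP => /cards1P[e0 S0].
have e0S : e0 \in S by rewrite S0 set11.
pose e0' : {e : E | e \in S} := exist _ e0 e0S.
have /negPn conn := nonsep e0'.
have [|e] := connected_by_nonloop (u := source (subgraph WS) e0')
  (v := target (subgraph WS) e0') conn.
  by rewrite /= !ffunE; apply: contra (noloop e0) => /eqP/(congr1 val)/= ->.
rewrite !inE => /eqP ee0 _; apply: ee0; apply: val_inj.
by have /set1P := eq_ind _ (fun A : {set E} => val e \in A) (valP e) _ S0.
Qed.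

(** The valences add up to 6 and are at least 3, so there are two vertices. Were
some edge a loop, the two others would join the two vertices, as neither of
them separates, and the vertex off the loop would have valence 2. *)
Lemma theta_graph (nv : nat) (G : multigraph 'I_nv 'I_3) :
  connected_graph G ->
  (forall v, valence G v <> 1%N /\ valence G v <> 2%N) ->
  (forall e, ~~ separating_edge G e) -> nv <> 1%N ->
  nv = 2%N /\ forall e, source G e != target G e.
Proof.
move=> conn val_G nonsep nv1.
have nv_gt1 : (1 < nv)%N.
  by have /andP[] := conn; rewrite card_ord; lia.
have val3 v : (3 <= valence G v)%N.
  have [u vu] : exists u, v != u.
    have [v0|v0] := eqVneq (v : nat) 0%N.
      by exists (Ordinal nv_gt1); apply/eqP => /(congr1 val) /=; lia.
    by exists (Ordinal (ltnW nv_gt1)); apply/eqP => /(congr1 val) /=; lia.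
  by have := connected_valence_gt0 conn vu; have := val_G v; lia.
have nv2 : nv = 2%N.
  have := sum_valence G; rewrite card_ord => sumv.
  have : (\sum_(v < nv) 3 <= \sum_v valence G v)%N by exact: leq_sum.
  by rewrite sumv sum_nat_const card_ord; lia.
split => //; subst nv => e0; apply/negP => /eqP loop0.
have nl (e' : 'I_3) : exists2 e, e != e' & source G e != target G e.
  have /negPn c := nonsep e'.
  have [e] := connected_by_nonloop (u := ord0) (v := ord_max) c isT.
  by rewrite !inE => ? ?; exists e.
have [e1 _ nl1] := nl e0; have [e2 e21 nl2] := nl e1.
have e10 : e1 != e0 by apply: contraNneq nl1 => ->; rewrite loop0.
have e20 : e2 != e0 by apply: contraNneq nl2 => ->; rewrite loop0.
have [w w0] : exists w : 'I_2, w != source G e0.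
  have [v0|v0] := eqVneq (source G e0) ord0.
    by exists ord_max; rewrite v0.
  by exists ord0; rewrite eq_sym.
have [_ []] := val_G w.
rewrite valence_sum (bigD1 e0)//= -loop0 eq_sym (negbTE w0) add0n.
rewrite (eq_bigr (fun=> 1%N)) => [|e ee0].
  by rewrite sum_nat_const (eq_card (B := predC1 e0))// cardC1 card_ord.
have nle : source G e != target G e.
  have [-> //|ne1] := eqVneq e e1; have [-> //|ne2] := eqVneq e e2.
  exfalso; move: ee0 e10 e20 e21 ne1 ne2.
  rewrite -!val_eqE /=.
  move: (ltn_ord e) (ltn_ord e0) (ltn_ord e1) (ltn_ord e2).
  by lia.
move: nle; rewrite -!val_eqE /=.
move: (ltn_ord (source G e)) (ltn_ord (target G e)) (ltn_ord w).
by case: eqP => ?; case: eqP => ?; case: eqP => ? //=; lia.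
Qed.

(** One vertex would mean a bouquet of three circles equivalent to the rose. *)
Lemma marked_theta (R : realType) (M : marked_graph R 2) : mg_ne M = 3%N ->
  mg_nv M = 2%N /\ forall e, source (mg_graph M) e != target (mg_graph M) e.
Proof.
case: M => nv ne G h conn val_G nonsep heq /= ne3; subst ne.
apply: theta_graph => // nv1; subst nv.
have [ch [g [cg gh _]]] := heq.
suff : (3 <= 2)%N by [].
have one1 (v : 'I_1) : v = ord0 by rewrite ord1.
have one2 (v : unit) : v = tt by case: v.
exact: (bouquet_retract_rank one1 one2 ch cg gh).
Qed.

(** * Orbits of simplices *)
Section Orbits.
Context (R : realType) (n : nat).
Local Notation mmg := (marked_metric_graph R n).
Implicit Types (A B C : mmg) (M : marked_graph R n)
  (phi : rose_equiv R n).

Lemma mm_equiv_refl A : mm_equiv A A.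
Proof.
exists id; split; last exact: homotopic_refl (mg_equiv A).1.
split => //; first exact: (fun x => cvg_id).
by exists id; split => //; exact: (fun x => cvg_id).
Qed.

Lemma mm_equiv_sym A B : mm_equiv A B -> mm_equiv B A.
Proof.
case=> f [[cf [g [cg fg gf]] df] hf]; exists g; split.
  by split => //; [exists f|move=> p q; rewrite -df !gf].
apply: homotopic_sym; have := homotopic_compr cg hf.
rewrite (_ : (mg_marking B \o f) \o g = mg_marking B)//.
by apply/funext => x /=; rewrite gf.
Qed.

Lemma mm_equiv_trans B A C : mm_equiv A B -> mm_equiv B C -> mm_equiv A C.
Proof.
case=> f [[cf [f' [cf' ff' f'f]] df] hf] [g [[cg [g' [cg' gg' g'g]] dg] hg]].
exists (g \o f); split; last first.
  exact: homotopic_trans (homotopic_compr cf hg) hf.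
split; first by move=> x; apply: continuous_comp; [exact: cf|exact: cg].
  exists (f' \o g'); split.
  - by move=> x; apply: continuous_comp; [exact: cg'|exact: cf'].
  - exact: can_comp.
  - exact: can_comp.
by move=> p q /=; rewrite dg df.
Qed.

Lemma mm_equiv_act phi A B : mm_equiv A B ->
  mm_equiv (act_metric phi A) (act_metric phi B).
Proof.
case=> f [isof hf]; exists f; split => //.
exact: (homotopic_compl (proj2_sig phi).1 hf).
Qed.

Lemma os_class_eq A B : mm_equiv A B -> os_class A = os_class B.
Proof.
move=> AB; apply/seteqP; split => C /=; apply: mm_equiv_trans => //.
exact: mm_equiv_sym.
Qed.

Lemma out_act_class phi A :
  out_act phi (os_class A) = os_class (act_metric phi A).
Proof.
apply/seteqP; split=> [C [B /= AB BC]|C AC].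
  exact: mm_equiv_trans (mm_equiv_act phi AB) BC.
by exists A => //; exact: mm_equiv_refl.
Qed.

Lemma out_act_simplex phi M :
  out_act phi @` os_simplex M = os_simplex (act_marked phi M).
Proof.
apply/seteqP; split => [_ [_ [A /= <- <-] <-]|_ [A /= + <-]].
  by rewrite out_act_class; exists (act_metric phi A).
case: A => M' l l0 l1 /= M'E; subst M'.
pose A := @MarkedMetricGraph R n M l l0 l1.
by exists (os_class A); [exists A|rewrite out_act_class].
Qed.

(** The identity of the graph is an equivalence of the two marked graphs. *)
Lemma os_simplex_homotopic nv ne (G : multigraph 'I_nv 'I_ne)
    (h h' : realization R G -> rose_space R n)
    conn conn' val val' nonsep nonsep' heq heq' :
  homotopic R h h' ->
  os_simplex (@MarkedGraph R n nv ne G h conn val nonsep heq) =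
  os_simplex (@MarkedGraph R n nv ne G h' conn' val' nonsep' heq').
Proof.
move=> hh'; set M := MarkedGraph _ _ _ _; set M' := MarkedGraph _ _ _ _.
have key l l0 l1 : os_class (@MarkedMetricGraph R n M l l0 l1) =
    os_class (@MarkedMetricGraph R n M' l l0 l1).
  apply: os_class_eq; exists id; split; last exact: homotopic_sym.
  split => //; first exact: (fun x => cvg_id).
  by exists id; split => //; exact: (fun x => cvg_id).
apply/seteqP; split => _ [[N l l0 l1] /= NE <-]; subst N.
  by rewrite key; exists (@MarkedMetricGraph R n M' l l0 l1).
by rewrite -key; exists (@MarkedMetricGraph R n M l l0 l1).
Qed.

(** If k is a homotopy inverse of the marking h', the self equivalence
phi \o h \o k of the rose carries h' to phi \o h. *)
Lemma out_orbit_graph_subset nv ne (G : multigraph 'I_nv 'I_ne)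
    (h h' : realization R G -> rose_space R n)
    conn conn' val val' nonsep nonsep' heq heq' :
  out_orbit (os_simplex (@MarkedGraph R n nv ne G h conn val nonsep heq)) `<=`
  out_orbit (os_simplex (@MarkedGraph R n nv ne G h' conn' val' nonsep' heq')).
Proof.
move=> _ [phi _ <-]; rewrite out_act_simplex.
have [ch' [k [ck kh' h'k]]] := heq'.
have keq : is_homotopy_equiv R k by split => //; exists h'.
have psiP := homotopy_equiv_comp keq (homotopy_equiv_comp heq (proj2_sig phi)).
exists (exist _ _ psiP) => //; rewrite out_act_simplex.
apply: os_simplex_homotopic => /=.
have cphih : continuous (sval phi \o h).
  by move=> x; apply: continuous_comp; [exact: heq.1|exact: (proj2_sig phi).1].
exact: (homotopic_compl cphih kh').
Qed.

End Orbits.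

(** An orbit is determined by the source and target maps of its graph. *)
Lemma finite_theta_orbits (R : realType) :
  finite_set (@out_orbit R 2 @` os_simplices R 2 2).
Proof.
pose has_graph (st : {ffun 'I_3 -> 'I_2} * {ffun 'I_3 -> 'I_2}) O :=
  exists h conn val nonsep heq, O = out_orbit (os_simplex
    (@MarkedGraph R 2 2 3 (Multigraph st.1 st.2) h conn val nonsep heq)).
pose orb st := get (has_graph st).
apply: (@sub_finite_set _ _ (orb @` setT)); last first.
  exact: finite_image finite_finset.
move=> _ [_ [M /= M3 <-] <-].
have [M2 _] := marked_theta M3.
case: M M2 M3 => nv ne [s t] h conn val nonsep heq /= ? ?; subst nv ne.
exists (s, t) => //; rewrite /orb.
case: xgetP => [_ _ [h' [conn' [val' [nonsep' [heq' ->]]]]]|].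
  by apply/seteqP; split; exact: out_orbit_graph_subset.
move=> /(_ (out_orbit (os_simplex (MarkedGraph conn val nonsep heq)))); case.
by exists h, conn, val, nonsep, heq.
Qed.

(** * An integral over a triangle *)

(** The integral of a nonnegative function is the supremum of the integrals of
the simple functions below it. This gives monotonicity without measurability,
so that the Gram determinant can be bounded with no further property of the
derivative of lam. *)
Lemma ge0_le_integral_nonmeasurable d (T : measurableType d) (R : realType)
    (mu : {measure set T -> \bar R}) (D : set T) (f g : T -> \bar R) :
  (forall x, D x -> (0 <= f x)%E) -> (forall x, (0 <= g x)%E) ->
  (forall x, D x -> (f x <= g x)%E) ->
  (\int[mu]_(x in D) f x <= \int[mu]_x g x)%E.
Proof.
move=> f0 g0 fg; rewrite integral_mkcond.
have fD0 x : (0 <= (f \_ D) x)%E.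
  by rewrite patchE; case: ifPn => // /set_mem; exact: f0.
rewrite !ge0_integralTE//; apply: ereal_sup_le => _ [h /= hf <-].
exists h => // x; apply: le_trans (hf x) _.
by rewrite patchE; case: ifPn => // /set_mem; exact: fg.
Qed.

Section Hypograph.
Context (R : realType).
Local Notation mu := (@lebesgue_measure R).
Implicit Types (b : R -> R) (p : R * R).

(** The function 1/b(s) on the part of the hypograph of b above (0, 1). Its
integral along each vertical segment is 1, which makes it integrable however
singular 1/b is. *)
Definition hypo_density b p : R :=
  if [&& 0 < p.1, p.1 < 1, 0 < p.2 & p.2 <= b p.1] then b p.1 `^ (-1) else 0.

Lemma hypo_density_ge0 b p : 0 <= hypo_density b p.
Proof. by rewrite /hypo_density; case: ifP => // _; exact: powR_ge0. Qed.

Lemma measurable_hypo_density b : measurable_fun setT b ->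
  measurable_fun setT (hypo_density b).
Proof.
move=> mb; have mb1 : measurable_fun setT (fun p : R * R => b p.1).
  exact: measurableT_comp mb measurable_fst.
apply: measurable_fun_ifT; last exact: measurable_cst.
  apply: measurable_and; first exact: measurable_fun_ltr.
  apply: measurable_and; first exact: measurable_fun_ltr.
  apply: measurable_and; first exact: measurable_fun_ltr.
  exact: measurable_fun_ler.
exact: (@measurableT_comp _ _ _ _ _ _ (@powR R ^~ (-1))).
Qed.

Lemma hypo_density_iterated b :
  (\int[mu]_s \int[mu]_t (hypo_density b (s, t))%:E <= 1)%E.
Proof.
have -> : (1 = \int[mu]_x (\1_(`]0, 1[%classic : set R) x)%:E)%E.
  rewrite integral_indic// setIT /= lebesgue_measure_itv /= lte_fin ltr01.
  by rewrite oppr0 adde0.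
apply: ge0_le_integral_nonmeasurable => [s _|s|s _].
- by apply: integral_ge0 => t _; rewrite lee_fin hypo_density_ge0.
- by rewrite lee_fin.
have [/andP[s01 bs0]|s01] := boolP ((0 < s < 1) && (0 < b s)); last first.
  rewrite (eq_integral (cst 0%E)) ?integral0 ?lee_fin// => t _.
  rewrite /hypo_density /=; case: ifPn => // /and4P[s0 s1 t0 tb].
  by move: s01; rewrite s0 s1 (lt_le_trans t0 tb).
have /andP[s0 s1] := s01.
rewrite indicE mem_set /= ?in_itv//=.
rewrite (_ : (fun t => (hypo_density b (s, t))%:E) =
    (fun t => (b s)^-1%:E * (\1_(`]0, b s]%classic : set R) t)%:E)%E); last first.
  apply/funext => t; rewrite /hypo_density /= s0 s1 /= indicE -EFinM.
  congr _%:E.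
  have [tb|tb] := boolP (0 < t <= b s).
    by rewrite mem_set ?mulr1 ?powR_inv1 ?ltW//= in_itv.
  by rewrite memNset ?mulr0//= in_itv /=; apply/negP.
rewrite ge0_integralZl_EFin//; last 2 first.
- by apply/measurable_EFinP; exact: measurable_indic.
- by rewrite invr_ge0 ltW.
rewrite integral_indic// setIT /= lebesgue_measure_itv /= lte_fin bs0.
by rewrite oppr0 adde0 -EFinM mulVf ?gt_eqF.
Qed.

Lemma hypo_density_integral b : measurable_fun setT b ->
  (\int[(mu \x mu)%E]_p (hypo_density b p)%:E <= 1)%E.
Proof.
move=> mb; rewrite fubini_tonelli1.
- exact: hypo_density_iterated.
- by apply/measurable_EFinP; exact: measurable_hypo_density.
- by move=> p; rewrite lee_fin hypo_density_ge0.
Qed.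

Lemma measurable_hypo_density_swap b : measurable_fun setT b ->
  measurable_fun setT (fun p => hypo_density b (p.2, p.1)).
Proof.
move=> mb; apply: (measurableT_comp (measurable_hypo_density mb)).
exact: measurable_swap.
Qed.

Lemma hypo_density_swap_integral b : measurable_fun setT b ->
  (\int[(mu \x mu)%E]_p (hypo_density b (p.2, p.1))%:E <= 1)%E.
Proof.
move=> mb; rewrite fubini_tonelli2.
- exact: hypo_density_iterated.
- by apply/measurable_EFinP; exact: measurable_hypo_density_swap.
- by move=> p; rewrite lee_fin hypo_density_ge0.
Qed.

(** On the triangle, each of the three singular functions is bounded by
hypograph densities: 1/(1 - s) is the density for b(s) = 1 - s since t < 1 - s,
and 1/(s + t) is at most the inverse of the greater of s and t, which is the
density for b(s) = s or its mirror image. The constant 2 is absorbed in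
1/(1 - s) >= 1. *)
Lemma triangle_integral_le (C : R) (f : R * R -> R) : 0 <= C ->
  (forall p, chart_domain p -> 0 <= f p <=
    2 + 3 * C * ((p.1 + p.2)^-1 + (1 - p.1)^-1 + (1 - p.2)^-1)) ->
  (\int[(mu \x mu)%E]_(p in @chart_domain R) (f p)%:E <=
   (4 * (2 + 3 * C))%:E)%E.
Proof.
move=> C0 f_bd; pose b1 : R -> R := id; pose b2 (s : R) := 1 - s.
have mb1 : measurable_fun setT b1 by exact: measurable_id.
have mb2 : measurable_fun setT b2 by apply: measurable_funB.
pose h b p := hypo_density b p + hypo_density b (p.2, p.1).
have h0 b p : 0 <= h b p by rewrite addr_ge0 ?hypo_density_ge0.
have mh b : measurable_fun setT b -> measurable_fun setT (h b).
  move=> mb; apply: measurable_funD; first exact: measurable_hypo_density.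
  exact: measurable_hypo_density_swap.
have ih b : measurable_fun setT b ->
    (\int[(mu \x mu)%E]_p (h b p)%:E <= 1 + 1)%E.
  move=> mb; under eq_integral do rewrite EFinD.
  rewrite ge0_integralD//.
  - apply: leeD; [exact: hypo_density_integral|exact: hypo_density_swap_integral].
  - by move=> p _; rewrite lee_fin hypo_density_ge0.
  - by apply/measurable_EFinP; exact: measurable_hypo_density.
  - by move=> p _; rewrite lee_fin hypo_density_ge0.
  - by apply/measurable_EFinP; exact: measurable_hypo_density_swap.
have M0 : 0 <= 2 + 3 * C by rewrite addr_ge0// mulr_ge0.
apply: (@le_trans _ _ (\int[(mu \x mu)%E]_p
    ((2 + 3 * C)%:E * ((h b1 p)%:E + (h b2 p)%:E)))%E).
  apply: ge0_le_integral_nonmeasurable => p.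
  - by move=> /f_bd /andP[f0 _]; rewrite lee_fin.
  - by rewrite -EFinD -EFinM lee_fin mulr_ge0// addr_ge0.
  move=> Dp; have [s0 t0 st1] := Dp; have /andP[_ fp] := f_bd p Dp.
  rewrite -EFinD -EFinM lee_fin; apply: le_trans fp _.
  case: p s0 t0 st1 {Dp} => s t /= s0 t0 st1.
  have s1 : 0 < 1 - s by lra.
  have t1 : 0 < 1 - t by lra.
  have s_lt1 : s < 1 by lra.
  have t_lt1 : t < 1 by lra.
  have h2E : h b2 (s, t) = (1 - s)^-1 + (1 - t)^-1.
    have [ts st] : t <= 1 - s /\ s <= 1 - t by split; lra.
    rewrite /h /hypo_density /b2 /= s0 t0 s_lt1 t_lt1 ts st.
    by rewrite !powR_inv1 ?(ltW s1) ?(ltW t1).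
  have h1E : (s + t)^-1 <= h b1 (s, t).
    have [ts|st] := leP t s.
      apply: le_trans (_ : s^-1 <= _).
        by rewrite lef_pV2 ?posrE ?addr_gt0// lerDl ltW.
      rewrite /h {1}/hypo_density /= s0 t0 /b1 ts s_lt1 /=.
      by rewrite powR_inv1 ?(ltW s0)// lerDl hypo_density_ge0.
    apply: le_trans (_ : t^-1 <= _).
      by rewrite lef_pV2 ?posrE ?addr_gt0// lerDr ltW.
    rewrite /h {2}/hypo_density /= s0 t0 /b1 (ltW st) t_lt1 /=.
    by rewrite powR_inv1 ?(ltW t0)// lerDr hypo_density_ge0.
  rewrite h2E; move: h1E (h0 b1 (s, t)); set H := h b1 _; set z := (s + t)^-1.
  have : 1 <= (1 - s)^-1 by rewrite invr_ge1 ?unitfE ?gt_eqF//; lra.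
  have : 0 < (1 - t)^-1 by rewrite invr_gt0.
  set x := (1 - s)^-1; set y := (1 - t)^-1 => y0 x1 zH H0.
  have CH : C * z <= C * H by exact: ler_wpM2l.
  by nra.
rewrite ge0_integralZl_EFin//; last 2 first.
- by move=> p _; rewrite -EFinD lee_fin addr_ge0.
- under eq_fun do rewrite -EFinD.
  by apply/measurable_EFinP; apply: measurable_funD; exact: mh.
rewrite (mulrC 4) EFinM; apply: lee_wpmul2l; first by rewrite lee_fin.
rewrite ge0_integralD//; first last.
- by apply/measurable_EFinP; exact: mh.
- by move=> p _; rewrite lee_fin.
- by apply/measurable_EFinP; exact: mh.
- by move=> p _; rewrite lee_fin.
apply: le_trans (leeD (ih _ mb1) (ih _ mb2)) _.
by rewrite -!EFinD lee_fin; lra.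
Qed.

End Hypograph.

(** * Differentials of cycle lengths *)
Section Cutoff.
Context (R : realType) (eps : R) (lam : R -> R).
Hypotheses (eps_gt0 : 0 < eps) (lam_cutoff : is_cutoff eps lam).

Lemma cutoff_derivable t : 0 < t -> derivable lam t 1.
Proof. by have [_ d _ _] := lam_cutoff; exact: (d 0%N t). Qed.

(** The logarithmic derivative of lam is 1/t below eps, and it is bounded on the
compact interval [eps, 2 eps] because lam is positive and C^1 there. *)
Lemma cutoff_logder : exists2 C : R, 0 <= C &
  forall t, 0 < t < 2 * eps -> `|derive1 lam t / lam t| <= C / t.
Proof.
have [lam_gt0 d _ lam_id] := lam_cutoff.
have e0 := eps_gt0; have e2 : eps <= 2 * eps by lra.
pose q t := `|derive1 lam t / lam t|.
have cq : {within `[eps, 2 * eps], continuous q}.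
  apply: continuous_in_subspaceT => t; rewrite inE /= in_itv /= => /andP[te _].
  have t0 : 0 < t by exact: lt_le_trans te.
  have c1 : {for t, continuous (derive1 lam)}.
    apply/differentiable_continuous; apply/derivable1_diffP.
    exact: (d 1%N t t0).
  have c0 : {for t, continuous lam}.
    by apply/differentiable_continuous; apply/derivable1_diffP; exact: (d 0%N t t0).
  apply: cvg_norm; apply: cvgM => //; apply: cvgV => //.
  by rewrite gt_eqF// lam_gt0.
have [c _ qc] := EVT_max e2 cq.
exists (1 + q c * (2 * eps)).
  by rewrite addr_ge0// mulr_ge0// ?normr_ge0//; lra.
move=> t /andP[t0 t2]; rewrite ler_pdivlMr//.
have [te|te] := ltP t eps; last first.
  have qt : q t <= q c by apply: qc; rewrite in_itv /= te ltW.
  have q0 : 0 <= q t by exact: normr_ge0.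
  rewrite -/(q t).
  have : q t * t <= q c * (2 * eps) by apply: ler_pM => //; exact: ltW.
  lra.
have -> : derive1 lam t = 1.
  rewrite derive1E (@near_eq_derive _ _ _ lam id t 1) ?derive_id//.
  near=> s; apply: lam_id; [near: s; exact: lt_nbhsr|].
  by apply: ltW; near: s; exact: lt_nbhsl.
rewrite (lam_id _ t0 (ltW te)) mul1r ger0_norm ?invr_ge0 ?(ltW t0)//.
rewrite mulVf ?gt_eqF// lerDl mulr_ge0 ?normr_ge0//; lra.
Unshelve. all: by end_near. Qed.

Section Derivative.
Context (V : finType) (k : nat) (sigma : {set V} * {set 'I_k}).

Lemma cycle_lengthD x y :
  cycle_length (R := R) sigma (x + y) =
  cycle_length sigma x + cycle_length sigma y.
Proof.
by rewrite /cycle_length -big_split; apply: eq_bigr => e _; rewrite mxE.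
Qed.

Lemma cycle_lengthZ a x :
  cycle_length (R := R) sigma (a *: x) = a * cycle_length sigma x.
Proof.
by rewrite /cycle_length mulr_sumr; apply: eq_bigr => e _; rewrite mxE.
Qed.

Lemma derive_cycle_length_eps_dir (x u : 'rV[R]_k) :
  'D_u (cycle_length_eps lam sigma) x =
  'D_(cycle_length sigma u) lam (cycle_length sigma x).
Proof.
rewrite /derive; set q := (fun h : R => _); set q' := (fun h : R => _).
suff -> : q = q' by [].
apply/funext => h; rewrite /q /q' /=.
by rewrite /cycle_length_eps cycle_lengthD cycle_lengthZ.
Qed.

Lemma derive_cycle_length_eps (x u : 'rV[R]_k) : 0 < cycle_length sigma x ->
  'D_u (cycle_length_eps lam sigma) x =
  derive1 lam (cycle_length sigma x) * cycle_length sigma u.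
Proof.
move=> l0; have dlam := (derivable1_diffP _ _).1 (cutoff_derivable l0).
rewrite derive_cycle_length_eps_dir deriveE// derive1E'//.
set c := cycle_length sigma u.
have -> : c = c *: (1 : R^o) by rewrite /GRing.scale /= mulr1.
by rewrite linearZ /= mulrC /GRing.scale /= mulr1.
Qed.

(** This covers the cycles reduced to a vertex, whose length 0 is outside the
domain where lam is regular. *)
Lemma derive_cycle_length_eps0 (x u : 'rV[R]_k) : cycle_length sigma u = 0 ->
  'D_u (cycle_length_eps lam sigma) x = 0.
Proof.
move=> u0; rewrite derive_cycle_length_eps_dir u0 /derive.
rewrite (_ : (fun h => _) = cst 0); first exact: lim_cst.
by apply/funext => h /=; rewrite scaler0 add0r subrr scaler0.
Qed.

End Derivative.

End Cutoff.

(** * The volume element of a theta graph *)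
Lemma det_mx2 (R : comPzRingType) (A : 'M[R]_2) :
  \det A = A 0 0 * A 1 1 - A 0 1 * A 1 0.
Proof.
rewrite (expand_det_row _ 0) !big_ord_recl big_ord0 addr0 /cofactor.
rewrite !det_mx11 !mxE /=.
rewrite expr0 mul1r expr1 mulN1r mulrN.
by congr (A _ _ * A _ _ - A _ _ * A _ _); apply: val_inj.
Qed.

Lemma ord2_eq (a b v : 'I_2) : a != b -> v != a -> v = b.
Proof.
case: a => -[|[|//]] ?; case: b => -[|[|//]] ?; case: v => -[|[|//]] ? //= _ _;
  exact: val_inj.
Qed.

Section ThetaMetric.
Context (R : realType) (eps : R) (lam : R -> R).
Hypotheses (eps_lt : eps < 12^-1) (lam_cutoff : is_cutoff eps lam).
Context (G : multigraph 'I_2 'I_3).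
Hypothesis noloop : forall e, source G e != target G e.

Section Point.
Context (x : 'rV[R]_3) (x_gt0 : forall e, 0 < x 0 e) (x_sum : \sum_e x 0 e = 1).

Lemma cycle_length_setC1 (W : {set 'I_2}) e (y : 'rV[R]_3) :
  cycle_length (W, [set~ e]%SET) y = \sum_i y 0 i - y 0 e.
Proof.
rewrite /cycle_length [in RHS](bigD1 e)//= addrC addrK.
by apply: eq_bigl => i; rewrite !inE.
Qed.

(** A cycle with all the edges would have length 1, and one edge is not enough
in a graph without loops. The empty set of edges is that of a single vertex. *)
Lemma short_cycle_edges sigma : is_cycle R G sigma ->
  cycle_length sigma x < 2 * eps ->
  sigma.2 = finset.set0 \/ exists e, sigma.2 = [set~ e]%SET.
Proof.
case: sigma => W S [/= WS [_ nonsep _]] short.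
have S1 := cycle_not_one_edge noloop nonsep.
have S3 : #|S| != 3%N.
  apply/negP => /eqP cS; have SE : S = [set: 'I_3]%SET.
    by apply/eqP; rewrite eqEcard finset.subsetT cardsT card_ord cS.
  have : cycle_length (W, S) x = 1.
    by rewrite -x_sum /cycle_length SE; apply: eq_bigl => i; rewrite inE.
  by move: short (eps_lt) => /[swap] ? /[swap] ->; lra.
have cS := max_card (mem S); rewrite card_ord in cS.
have [S0|S0] := eqVneq #|S| 0%N; first by left; exact: cards0_eq.
have /cards1P[e eS] : #|(~: S)%SET| == 1%N.
  by have := cardsC S; rewrite card_ord; lia.
by right; exists e; rewrite -eS finset.setCK.
Qed.

(** The lengths of the cycles missing e and e' add up to 2 - x e - x e' >= 1. *)
Lemma short_cycle_unique W W' e e' :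
  is_cycle R G (W, [set~ e]%SET) -> is_cycle R G (W', [set~ e']%SET) ->
  cycle_length (W, [set~ e]%SET) x < 2 * eps ->
  cycle_length (W', [set~ e']%SET) x < 2 * eps -> (W, e) = (W', e').
Proof.
move=> [WS _] [WS' _]; rewrite !cycle_length_setC1 x_sum => s s'.
have full (U : {set 'I_2}) d :
      is_subgraph G U [set~ d]%SET -> U = [set: 'I_2]%SET.
  move=> /forall_inP US; have [d' dd'] : exists d', d' != d.
    by case: (eqVneq d ord0) => [->|d0];
      [exists ord_max|exists ord0; rewrite eq_sym].
  have /andP[sU tU] : (source G d' \in U) && (target G d' \in U).
    by apply: US; rewrite !inE.
  apply/setP => v; rewrite inE.
  have [->//|vs] := eqVneq v (source G d').
  suff -> : v = target G d' by [].
  exact: ord2_eq (noloop d') vs.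
rewrite (full W _ WS) (full W' _ WS'); congr (_, _).
apply/eqP/negPn/negP => ee'.
have : x 0 e + x 0 e' <= 1.
  rewrite -x_sum (bigD1 e)//= (bigD1 e')//= 1?eq_sym// addrA lerDl.
  by apply: sumr_ge0 => i _; exact: ltW.
by move: (eps_lt); lra.
Qed.

(** The only short cycle with edges, if any, is the one missing some edge e. It
contributes (d lam(l) / lam(l))^2 with l = 1 - x e, and dl = - dx_e on tangent
vectors, whose coordinates add up to 0. Without such a cycle take c = 0. *)
Lemma ds2_rank_one (C : R) : 0 <= C ->
  (forall t, 0 < t < 2 * eps -> `|derive1 lam t / lam t| <= C / t) ->
  exists c e, `|c| <= C / (1 - x 0 e) /\
    forall u v : 'rV[R]_3, \sum_i u 0 i = 0 -> \sum_i v 0 i = 0 ->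
    ds2 eps lam G x u v =
      \sum_i u 0 i * v 0 i + c ^+ 2 * (u 0 e * v 0 e).
Proof.
move=> C0 HC.
have x1 e : 0 < 1 - x 0 e.
  have [e' ee'] : exists e', e' != e.
    by case: (eqVneq e ord0) => [->|e0];
      [exists ord_max|exists ord0; rewrite eq_sym].
  rewrite -x_sum (bigD1 e)//= addrC addrK (bigD1 e')//=.
  by rewrite ltr_pwDl// sumr_ge0// => i _; exact: ltW.
pose short sigma :=
  `[< is_cycle R G sigma >] && (cycle_length sigma x < 2 * eps).
have [/existsP[[W S] /andP[shortS S0]]|none] :=
    boolP [exists sigma, short sigma && (sigma.2 != finset.set0)]; last first.
  exists 0, ord0; split; first by rewrite normr0 divr_ge0// ltW.
  move=> u v _ _; rewrite expr0n mul0r; congr (_ + _).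
  apply: big1 => sigma ssigma.
  have : ~~ (short sigma && (sigma.2 != finset.set0)).
    by move/existsPn: none; exact.
  rewrite /short ssigma /= negbK => /eqP s0.
  rewrite derive_cycle_length_eps0 ?mul0r//.
  by rewrite /cycle_length s0 big_set0.
have /andP[/asboolP cycS lS] := shortS.
have [SE|[e SE]] := short_cycle_edges cycS lS; first by rewrite SE eqxx in S0.
move: SE S0 shortS cycS lS => /= -> _ shortS cycS lS.
set l := cycle_length (W, [set~ e]%SET) x.
have lE : l = 1 - x 0 e by rewrite /l cycle_length_setC1 x_sum.
have l0 : 0 < l by rewrite lE.
exists (derive1 lam l / lam l), e; split.
  by rewrite -lE; apply: HC; rewrite l0.
move=> u v u0 v0; congr (_ + _).
rewrite (bigD1 (W, [set~ e]%SET))//= big1 ?addr0.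
  rewrite !(derive_cycle_length_eps lam_cutoff)// /cycle_length_eps -/l.
  rewrite !cycle_length_setC1 u0 v0.
  by rewrite !sub0r; move: (lam l)^-1 => w; ring.
move=> [W' S'] /andP[ssigma ne].
have /andP[/asboolP cycS' lS'] := ssigma.
have [/= s0|[e' /= S'E]] := short_cycle_edges cycS' lS'.
  rewrite derive_cycle_length_eps0 ?mul0r//.
  by rewrite /cycle_length s0 big_set0.
subst S'; have [WW ee] := short_cycle_unique cycS cycS' lS lS'.
by rewrite WW ee eqxx in ne.
Qed.

End Point.

Lemma chart_gt0 (p : R * R) : chart_domain p -> forall e, 0 < @chart R 3 p 0 e.
Proof.
move=> [s0 t0 st1] e; rewrite mxE.
case: e => -[|[|[|//]]] /= _ //; lra.
Qed.

Lemma chart_sum (p : R * R) : \sum_e @chart R 3 p 0 e = 1.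
Proof. by rewrite !big_ord_recl big_ord0 !mxE /=; lra. Qed.

Lemma chart_vector_sum j : \sum_e @chart_vector R 3 j 0 e = 0.
Proof. by rewrite !big_ord_recl big_ord0 !mxE /=; case: ifP => _ /=; lra. Qed.

Lemma chart_vector_le1 j e : `|@chart_vector R 3 j 0 e| <= 1.
Proof.
rewrite mxE; case: e => -[|[|[|//]]] i /=; case: ifP => _ /=;
  by rewrite ?normrN ?normr1 ?normr0.
Qed.

(** With a, b the e-th coordinates of the two coordinate vector fields, the Gram
determinant is 3 + c^2 (2 a^2 + 2 b^2 - 2 a b), at most 3 + 6 c^2 and hence
at most (2 + 3 |c|)^2. *)
Lemma gram_sqrt_le (C : R) : 0 <= C ->
  (forall t, 0 < t < 2 * eps -> `|derive1 lam t / lam t| <= C / t) ->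
  forall p, chart_domain p ->
  0 <= Num.sqrt (\det (\matrix_(i < 2, j < 2)
        ds2 eps lam G (chart 3 p) (chart_vector R 3 i) (chart_vector R 3 j))) <=
    2 + 3 * C * ((p.1 + p.2)^-1 + (1 - p.1)^-1 + (1 - p.2)^-1).
Proof.
move=> C0 HC p Dp; rewrite sqrtr_ge0 /=.
have [c [e [ce ds2E]]] := ds2_rank_one (chart_gt0 Dp) (chart_sum p) C0 HC.
have [s0 t0 st1] := Dp.
set K := (p.1 + p.2)^-1 + _ + _.
have cK : `|c| <= C * K.
  apply: le_trans ce _; apply: ler_wpM2l => //; rewrite /K mxE.
  have i1 : 0 <= (p.1 + p.2)^-1 by rewrite invr_ge0; lra.
  have i2 : 0 <= (1 - p.1)^-1 by rewrite invr_ge0; lra.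
  have i3 : 0 <= (1 - p.2)^-1 by rewrite invr_ge0; lra.
  case: e {ds2E} => -[|[|[|//]]] i /=; [lra|lra|].
  rewrite (_ : 1 - (1 - p.1 - p.2) = p.1 + p.2); lra.
have CK0 : 0 <= C * K by exact: le_trans cK.
apply: (@le_trans _ _ (Num.sqrt ((2 + 3 * C * K) ^+ 2))); last first.
  by rewrite sqrtr_sqr ger0_norm// -mulrA; lra.
apply: ler_wsqrtr; rewrite det_mx2 !mxE !ds2E ?chart_vector_sum//.
have := chart_vector_le1 0 e; have := chart_vector_le1 1 e.
set a := chart_vector R 3 0 0 e; set b := chart_vector R 3 1 0 e => b1 a1.
have -> : \sum_i chart_vector R 3 0 0 i * chart_vector R 3 0 0 i = 2.
  by rewrite !big_ord_recl big_ord0 !mxE /=; lra.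
have -> : \sum_i chart_vector R 3 1 0 i * chart_vector R 3 1 0 i = 2.
  by rewrite !big_ord_recl big_ord0 !mxE /=; lra.
have -> : \sum_i chart_vector R 3 1 0 i * chart_vector R 3 0 0 i = 1.
  by rewrite !big_ord_recl big_ord0 !mxE /=; lra.
have -> : \sum_i chart_vector R 3 0 0 i * chart_vector R 3 1 0 i = 1.
  by rewrite !big_ord_recl big_ord0 !mxE /=; lra.
have a2 : a ^+ 2 <= 1 by rewrite -real_normK ?num_real// expr_le1.
have b2 : b ^+ 2 <= 1 by rewrite -real_normK ?num_real// expr_le1.
have c2 : c ^+ 2 <= (C * K) ^+ 2.
  by rewrite -real_normK ?num_real// lerXn2r ?nnegrE.
have ab : 2 * a ^+ 2 + 2 * b ^+ 2 - 2 * a * b <= 6.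
  have := sqr_ge0 (a + b); rewrite sqrrD; lra.
have := sqr_ge0 c; have := ler_wpM2l (sqr_ge0 c) ab.
set z := C * K in CK0 c2 *; rewrite -(mulrA 3) -/z => h1 h2.
have -> : (2 + c ^+ 2 * (a * a)) * (2 + c ^+ 2 * (b * b)) -
    (1 + c ^+ 2 * (a * b)) * (1 + c ^+ 2 * (b * a)) =
    3 + c ^+ 2 * (2 * a ^+ 2 + 2 * b ^+ 2 - 2 * a * b) by ring.
have z2 := sqr_ge0 z; rewrite sqrrD exprMn; lra.
Qed.

End ThetaMetric.

(** * Finiteness of the volumes *)
Lemma simplex_volume_bounded (R : realType) (eps : R) (lam : R -> R) :
  0 < eps -> eps < 12^-1 -> is_cutoff eps lam ->
  exists2 K : R, 0 <= K & forall sigma : set (set (marked_metric_graph R 2)),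
    (simplex_volume eps lam sigma <= K%:E)%E.
Proof.
move=> eps_gt0 eps_lt cut; have [C C0 HC] := cutoff_logder eps_gt0 cut.
exists (4 * (2 + 3 * C)); first by rewrite mulr_ge0// addr_ge0// mulr_ge0.
move=> sigma; apply: ge_ereal_sup => _ [M [M3 _] <-].
have [M2 noloop] := marked_theta M3.
case: M M2 M3 noloop => nv ne G h conn val nonsep heq /= ? ? noloop.
subst nv ne.
apply: triangle_integral_le => // p Dp.
exact: gram_sqrt_le.
Qed.

Lemma esum_finite_bounded (R : realType) (T : choiceType) (A : set T)
    (a : T -> \bar R) (K : R) : finite_set A -> 0 <= K ->
  (forall i, A i -> (a i <= K%:E)%E) -> (\esum_(i in A) a i < +oo)%E.
Proof.
move=> finA K0 aK; apply: le_lt_trans (le_esum aK) _.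
rewrite esum_fset//.
rewrite fsbig_finite//= sumEFin; exact: ltry.
Qed.

Theorem proposition11p4 (R : realType) (eps : R) (lam : R -> R)
    (eps_gt0 : 0 < eps) (eps_lt : eps < 12^-1) (lam_cutoff : is_cutoff eps lam) :
  (forall sigma, os_simplices R 2 2 sigma ->
     (simplex_volume eps lam sigma < +oo)%E) /\
  (quotient_volume eps lam < +oo)%E.
Proof.
have [K K0 volK] := simplex_volume_bounded eps_gt0 eps_lt lam_cutoff.
split=> [sigma _|]; first exact: le_lt_trans (volK sigma) (ltry K).
apply: (esum_finite_bounded (finite_theta_orbits R) K0) => O _.
by apply: ge_ereal_sup => _ [sigma _ <-].
Qed.
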